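(* Let $\beta\in\mathbb{C}$ with $|\beta|>1$, and let $A\subset\mathbb{C}$ be a finite alphabet. Then the spectrum $S_A(\beta)$ has an accumulation point if and only if $0$ has a rigid $(\beta,A)$-representation.
   Context: The $A$-spectrum of $\beta$ is $S_A(\beta)=\{\sum_{k=0}^n a_k\beta^k \mid n\in\mathbb{N},\ a_k\in A\}$, where $\mathbb{N}=\{0,1,2,\dots\}$. A point $s\in\mathbb{C}$ is an accumulation point of a set $X\subset\mathbb{C}$ if every neighbourhood of $s$ contains infinitely many elements of $X$. A $(\beta,A)$-representation of $0$ is an infinite word $z_1z_2z_3\cdots$ with all $z_i\in A$ and $\sum_{i\ge 1}z_i\beta^{-i}=0$. It is called rigid if for all $j\ge 2$ and all $z'_2,\dots,z'_j\in A$ one has $\sum_{i=1}^{j}z_i\beta^{-i}\neq\sum_{i=2}^{j}z'_i\beta^{-i}$.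
   Formalization: The direction ''rigid representation of 0 implies accumulation point'' is stated only for alphabets A containing 0; without this it fails, e.g. for β = 3, A = {1, −3} and the word 1 −3 1 −3 …. The other direction is for every finite A. *)

(* Defs.v *)
From HB Require Import structures.
From mathcomp Require Export all_boot all_order all_algebra.
From mathcomp Require Export all_classical all_reals all_analysis.
From mathcomp Require Export complex.
Export Order.TTheory GRing.Theory Num.Theory numFieldNormedType.Exports.

Set Implicit Arguments.
Unset Strict Implicit.
Unset Printing Implicit Defensive.

Local Open Scope classical_set_scope.
Local Open Scope ring_scope.

Definition spectrum (K : numFieldType) (A : set K) (beta : K) : set K :=
  [set s | exists (n : nat) (a : nat -> K),
     (forall k, (k <= n)%N -> A (a k)) /\
     s = \sum_(0 <= k < n.+1) a k * beta ^+ k].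

(* The library's [limit_point] only asks for one point of [X] other than [s]
   in each neighbourhood of [s]. *)
Definition accumulation_point (K : numFieldType) (X : set K) (s : K) : Prop :=
  forall U : set K, nbhs s U -> infinite_set (U `&` X).

(* The letters of a word z_1 z_2 z_3 ... are the values [z i] with [1 <= i];
   [z 0] plays no role. *)
Definition zero_representation (K : numFieldType) (A : set K) (beta : K)
    (z : nat -> K) : Prop :=
  (forall i, (1 <= i)%N -> A (z i)) /\
  (\sum_(1 <= i < n.+1) z i * beta ^- i) @[n --> \oo] --> (0 : K).

(* [z'] uses exactly the positions 2, ..., j, without zero padding. Hence if
   0 is not in [A], a rigid representation of 0 does not force an accumulation
   point: for beta = 3 and A = {1, -3}, the word (1 -3)(1 -3)(1 -3)... is rigid
   by parity, while the spectrum consists of integers. *)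
Definition rigid (K : numFieldType) (A : set K) (beta : K)
    (z : nat -> K) : Prop :=
  forall (j : nat) (z' : nat -> K),
    (2 <= j)%N -> (forall i, (2 <= i <= j)%N -> A (z' i)) ->
    \sum_(1 <= i < j.+1) z i * beta ^- i
      <> \sum_(2 <= i < j.+1) z' i * beta ^- i.

(* Main.v *)
(* Write P_j = z_1 beta^(j-1) + ... + z_j. As |beta| > 1, a word z represents 0
   if and only if the values P_j of its prefixes are bounded, and it is rigid if
   and only if P_j is never the value of a word of length j - 1.
   If the spectrum accumulates, infinitely many of its elements lie in a ball;
   their shortest words are arbitrarily long, all their prefixes are again
   shortest words of their values, and these values are uniformly bounded.
   Koenig's lemma gives an infinite word all of whose prefixes are such.
   Conversely, when 0 is a letter, rigidity makes the P_j pairwise distinct, and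
   a bounded infinite set accumulates by Bolzano-Weierstrass. *)
Require Import Defs.
Local Open Scope classical_set_scope.
Local Open Scope ring_scope.

Set Implicit Arguments.
Unset Strict Implicit.
Unset Printing Implicit Defensive.

(** * Words and their values *)

(* Words are stored with their last letter first, so that [horner_rec w beta]
   is the value of the word and the prefixes of a word are the tails of the list. *)
Fixpoint prefix_word (T : Type) (z : nat -> T) (n : nat) : seq T :=
  if n is m.+1 then z m.+1 :: prefix_word z m else [::].

Lemma size_prefix_word (T : Type) (z : nat -> T) n : size (prefix_word z n) = n.
Proof. by elim: n => //= n ->. Qed.

Lemma prefix_word_letters (T : eqType) (A : set T) (z : nat -> T) n :
  (forall i, (1 <= i <= n)%N -> A (z i)) -> [set` prefix_word z n] `<=` A.
Proof.
elim: n => [|n IH] zA a //=.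
rewrite inE => /orP[/eqP->|]; first by apply: zA; rewrite leqnn.
by apply: IH => i /andP[i0 ni]; apply: zA; rewrite i0 ltnW.
Qed.

Lemma sum_prefix_word (K : numFieldType) (beta : K) (z : nat -> K) n : beta != 0 ->
  \sum_(1 <= i < n.+1) z i * beta ^- i = horner_rec (prefix_word z n) beta * beta ^- n.
Proof.
move=> b0; elim: n => [|n IH] /=; first by rewrite big_nil mul0r.
rewrite big_nat_recr //= IH mulrDl; congr (_ + _).
by rewrite exprS invfM mulrA mulfK.
Qed.

Lemma horner_rec_sum (K : numFieldType) (w : seq K) (x : K) :
  horner_rec w x = \sum_(0 <= k < size w) w`_k * x ^+ k.
Proof.
rewrite -horner_Poly (horner_coef_wide _ (size_Poly w)) big_mkord.
by apply: eq_bigr => i _; rewrite coef_Poly.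
Qed.

Lemma spectrumP (K : numFieldType) (A : set K) (beta s : K) :
  spectrum A beta s <->
  exists w, [/\ (0 < size w)%N, [set` w] `<=` A & s = horner_rec w beta].
Proof.
split=> [[n [a [aA ->]]]|[w [w0 wA ->]]].
  exists (mkseq a n.+1); rewrite size_mkseq; split => //.
    by move=> x /mapP[k]; rewrite mem_iota /= add0n ltnS => kn ->; exact: aA.
  rewrite horner_rec_sum size_mkseq; apply: eq_big_nat => k /andP[_ kn].
  by rewrite nth_mkseq.
exists (size w).-1, (fun k => w`_k); rewrite prednK// -horner_rec_sum; split => // k kw.
by apply: wA; apply: mem_nth; rewrite -(prednK w0) ltnS.
Qed.

(** * Koenig's lemma over a finite alphabet *)

(** If every one-letter extension of [w] had extensions in [G] of bounded length only, then so would
    [w], the letters being finitely many. Hence a word with arbitrarily long extensions can be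
    prolonged by a letter that keeps this property. *)
Lemma koenig_words (T : choiceType) (A : set T) (G : seq T -> Prop) :
  finite_set A -> (forall a w, G (a :: w) -> A a /\ G w) ->
  (forall n, exists w, (n <= size w)%N /\ G w) ->
  exists z, forall n, G (prefix_word z n).
Proof.
move=> /finite_seqP[s As] Gtail Gbig.
pose ext w := forall n, exists v, (n <= size v)%N /\ G (v ++ w).
have Gcat v w : G (v ++ w) -> G w by elim: v => //= a v IH /Gtail[_ /IH].
have ext_step w : ext w -> exists a, ext (a :: w).
  move=> wext; apply: contrapT => nex.
  have bad a : {n | forall v, (n <= size v)%N -> ~ G (v ++ a :: w)}.
    apply: cid; apply: contrapT => na; apply: nex; exists a => n.
    apply: contrapT => nv; apply: na; exists n => v nv' Gv.
    by apply: nv; exists v.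
  (* [v] is longer than every bound in [bad]. Its last entry is the letter read right after [w], and
     the other entries are still too many for that letter. *)
  have [v [vs Gv]] := wext (\max_(a <- s) sval (bad a)).+1.
  case/lastP: v vs Gv => [//|v a]; rewrite size_rcons cat_rcons ltnS => vs Gv.
  have [Aa _] := Gtail _ _ (Gcat _ _ Gv).
  apply: (svalP (bad a) v) Gv; apply: leq_trans vs.
  by apply: (@leq_bigmax_seq _ s predT (fun a => sval (bad a))) => //; move: Aa; rewrite As.
have ext0 : ext [::] by move=> n; have [w] := Gbig n; exists w; rewrite cats0.
(* The second branch only makes [next] total: every [path n] satisfies [ext]. *)
pose next w := if pselect (ext w) is left e then sval (cid (ext_step w e))
  else sval (cid (ext_step _ ext0)).
pose fix path n := if n is m.+1 then next (path m) :: path m else [::].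
exists (fun i => next (path i.-1)) => n.
have -> : prefix_word (fun i => next (path i.-1)) n = path n.
  by elim: n => //= n ->.
have : ext (path n).
  elim: n => //= n IH; rewrite {1}/next; case: pselect => // e.
  exact: (svalP (cid (ext_step _ e))).
by move=> /(_ 0%N)[v [_ /Gcat]].
Qed.

(** * Shortest words, and the infinite word found from an accumulation point *)

Lemma finite_set_norm_bound (K : numFieldType) (A : set K) :
  finite_set A -> exists2 m : K, 0 <= m & forall a, A a -> `|a| <= m.
Proof.
move=> /finite_seqP[s ->]; exists (\sum_(a <- s) `|a|); first exact: sumr_ge0.
by move=> a /= sa; rewrite (big_rem a)//= lerDl sumr_ge0.
Qed.

Definition minimal_word (K : numFieldType) (A : set K) (beta : K) (w : seq K) : Prop :=
  [set` w] `<=` A /\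
  forall w', [set` w'] `<=` A -> horner_rec w' beta = horner_rec w beta ->
    (size w <= size w')%N.

(** The value of [a :: w] depends on [w] only through its value, so a shorter word for the latter,
    followed by [a], would shorten [a :: w]. *)
Lemma minimal_word_tail (K : numFieldType) (A : set K) (beta a : K) (w : seq K) :
  minimal_word A beta (a :: w) -> A a /\ minimal_word A beta w.
Proof.
move=> [awA awmin]; split; first by apply: awA; rewrite /= mem_head.
split=> [x xw|w' w'A w'w]; first by apply: awA; rewrite /= inE [x \in w]xw orbT.
suff : (size (a :: w) <= size (a :: w'))%N by [].
apply: awmin => /=; last by rewrite w'w.
move=> x /=; rewrite inE => /orP[/eqP->|/w'A//].
by apply: awA; rewrite /= mem_head.
Qed.

Lemma exists_minimal_word (K : numFieldType) (A : set K) (beta : K) (w : seq K) :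
  [set` w] `<=` A ->
  exists2 w', minimal_word A beta w' & horner_rec w' beta = horner_rec w beta.
Proof.
have [n] := ubnP (size w); elim: n w => // n IH w wn wA.
have [|nmin] := pselect (minimal_word A beta w); first by exists w.
have [w' [w'A w'w ltw]] :
    exists w', [/\ [set` w'] `<=` A, horner_rec w' beta = horner_rec w beta &
      (size w' < size w)%N].
  apply: contrapT => nex; apply: nmin; split=> // w' w'A w'w.
  by rewrite leqNgt; apply/negP => ltw; apply: nex; exists w'.
have [|w'' w''min w''w'] := IH w' _ w'A; first exact: leq_trans ltw _.
by exists w'' => //; rewrite w''w'.
Qed.

(** Infinitely many elements of the spectrum thus require arbitrarily long words. *)
Lemma finite_values (K : numFieldType) (A : set K) (beta : K) n :
  finite_set A ->
  finite_set [set x | exists w, [/\ (size w <= n)%N, [set` w] `<=` A &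
    x = horner_rec w beta]].
Proof.
move=> Afin; elim: n => [|n IH].
  by apply: (sub_finite_set _ (finite_set1 0)) => _ [[|a w] []] // _ _ ->.
apply: (@sub_finite_set _ _ ([set 0] `|`
  [set x * beta + a | x in [set x | exists w, [/\ (size w <= n)%N, [set` w] `<=` A &
    x = horner_rec w beta]] & a in A])); last first.
  by rewrite finite_setU; split; [exact: finite_set1|exact: finite_image2].
move=> _ [[|a w] [wn wA ->]]; [by left|right].
exists (horner_rec w beta) => /=.
  by exists w; split => // x xw; apply: wA; rewrite /= inE [x \in w]xw orbT.
by exists a => //; apply: wA; rewrite /= mem_head.
Qed.

(* The bound [C] is chosen so that it passes from a word to its prefixes. *)
Lemma accumulation_bounded_minimal_word (K : numFieldType) (A : set K) (beta s : K) :
  1 < `|beta| -> finite_set A -> accumulation_point (spectrum A beta) s ->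
  exists2 z : nat -> K, forall n, minimal_word A beta (prefix_word z n) &
    exists C, forall n, `|horner_rec (prefix_word z n) beta| <= C.
Proof.
move=> b1 Afin sacc; have [m m0 mA] := finite_set_norm_bound Afin.
have b10 : 0 < `|beta| - 1 by rewrite subr_gt0.
have b0 : 0 < `|beta| by exact: lt_trans b1.
(* The fraction gives [C + m <= C * |beta|], so that a bound [C] on the value of [a :: w] also
   bounds that of [w]; [|s| + 1] covers the unit ball around [s]. *)
pose C := `|s| + 1 + m / (`|beta| - 1).
have Cm : C + m <= C * `|beta|.
  rewrite -[C * _](subrK C) -{3}[C]mulr1 -mulrBr addrC lerD2r.
  by rewrite mulrDl divfK ?gt_eqF// lerDr mulr_ge0 ?(ltW b10)// addr_ge0.
pose G w := minimal_word A beta w /\ `|horner_rec w beta| <= C.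
have [|||z Gz] := @koenig_words _ A G.
- exact: Afin.
- move=> a w [/minimal_word_tail[Aa wmin] /= wC]; split=> //; split=> //.
  rewrite -(ler_pM2r b0) -normrM; apply: le_trans Cm.
  rewrite -[_ * _](addrK a); apply: le_trans (ler_normB _ _) _.
  by rewrite lerD// mA.
- move=> n; apply: contrapT => nG.
  (* If all words in [G] were shorter than [n], the points of the spectrum in this ball would be
     values of words of length at most [n], hence finitely many. *)
  apply: (sacc (ball s 1)); first by apply: nbhsx_ballx; exact: ltr01.
  apply: (sub_finite_set _ (finite_values beta n Afin)) => x [sx /spectrumP[w [_ wA xw]]].
  have [w' w'min w'w] := exists_minimal_word beta wA.
  exists w'; split; [|exact: w'min.1|by rewrite w'w].
  rewrite leqNgt; apply/negP => nw'; apply: nG; exists w'; split; first exact: ltnW.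
  split=> //; rewrite w'w -xw /C.
  have sx1 : `|s - x| < 1 by move: sx; rewrite -ball_normE.
  rewrite -[x](subKr s); apply: le_trans (ler_normB _ _) _.
  by rewrite -addrA lerD2l (le_trans (ltW sx1))// lerDl divr_ge0// ltW.
by exists z => [n|]; [exact: (Gz n).1|exists C => n; exact: (Gz n).2].
Qed.

(** * Convergence to 0 and bounded prefix values *)

(** [|beta|], [C] and [e] are comparable with 0, hence real, and taking real parts leaves a real
    geometric sequence. *)
Lemma near_complex_geometric (R : realType) (beta C e : R[i]) :
  1 < `|beta| -> 0 <= C -> 0 < e -> \forall n \near \oo, C * `|beta| ^- n < e.
Proof.
move=> b1 C0 e0.
have bE : `|beta| = (complex.Re `|beta|)%:C%C by rewrite RRe_real ?normr_real.
have CE : C = (complex.Re C)%:C%C by rewrite RRe_real ?ger0_real.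
have eE : e = (complex.Re e)%:C%C by rewrite RRe_real ?gtr0_real.
have b1' : 1 < complex.Re `|beta| by rewrite -ltcR -bE.
have b0' : 0 < complex.Re `|beta| by exact: lt_trans b1'.
have e0' : 0 < complex.Re e by rewrite -ltcR -eE.
have C0' : 0 <= complex.Re C by rewrite -lecR -CE.
have /cvgr0Pnorm_lt/(_ _ e0') : geometric (complex.Re C) (complex.Re `|beta|)^-1 @ \oo --> 0.
  by apply: cvg_geometric; rewrite ger0_norm ?invr_ge0 ?ltW// invf_lt1.
apply: filterS => n /=.
rewrite ger0_norm ?mulr_ge0 ?exprn_ge0 ?invr_ge0 ?(ltW b0')// => ltn.
by rewrite eE {1}CE bE -rmorphXn -fmorphV -rmorphM ltcR -exprVn.
Qed.

(** The value of the prefix of length j is [beta ^+ j] times a partial sum, which is minus the tail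
    of a series with sum 0 and so of order [|beta| ^- j]. *)
Lemma zero_representation_bounded (K : numFieldType) (A : set K) (beta : K) z :
  1 < `|beta| -> finite_set A -> zero_representation A beta z ->
  exists C, forall n, `|horner_rec (prefix_word z n) beta| <= C.
Proof.
move=> b1 Afin [zA zcvg]; have [m m0 mA] := finite_set_norm_bound Afin.
have b10 : 0 < `|beta| - 1 by rewrite subr_gt0.
have b0 : 0 < `|beta| by exact: lt_trans b1.
have beta0 : beta != 0 by rewrite -normr_gt0.
(* [M * |beta| ^- n] is the sum of [m * |beta| ^- i] over i > n; written this way, the estimate of
   finite tails telescopes. *)
pose M := m / (`|beta| - 1).
have M0 : 0 <= M by rewrite divr_ge0// ltW.
pose S n := \sum_(1 <= i < n.+1) z i * beta ^- i.
have step n : `|S n| <= `|S n.+1| + (M * `|beta| ^- n - M * `|beta| ^- n.+1).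
  have -> : M * `|beta| ^- n - M * `|beta| ^- n.+1 = m * `|beta| ^- n.+1.
    rewrite -[m in RHS](divfK (lt0r_neq0 b10)) -/M mulrBr mulr1 mulrBl.
    by rewrite exprS invfM [M * _ * (_ * _)]mulrA mulfK ?gt_eqF.
  have -> : S n = S n.+1 - z n.+1 * beta ^- n.+1.
    by rewrite /S [in RHS]big_nat_recr//= addrK.
  apply: le_trans (ler_normB _ _) _; rewrite lerD2l normrM normfV normrX.
  by rewrite ler_wpM2r ?invr_ge0 ?exprn_ge0//; apply/mA/zA.
have tail j k : `|S j| <= `|S (j + k)%N| + (M * `|beta| ^- j - M * `|beta| ^- (j + k)).
  elim: k => [|k IH]; first by rewrite addn0 subrr addr0.
  apply: le_trans IH _; rewrite addnS -lerBrDr.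
  by rewrite -[leRHS]addrA opprB [X in _ + X]addrC subrKA; exact: step.
(* The 1 pays for the far partial sum [S (j + N)], known only to be below [|beta| ^- j]. *)
exists (M + 1) => j.
have bj : 0 < `|beta| ^- j by rewrite invr_gt0 exprn_gt0.
have [N _ Nlt] : \forall n \near \oo, `|S n| < `|beta| ^- j by exact: cvgr0_norm_lt.
rewrite -(ler_pM2r bj) -normrX -normfV -normrM -sum_prefix_word// -/(S j).
rewrite normfV normrX; apply: le_trans (tail j N) _.
rewrite mulrDl mul1r addrC lerD//; last by apply: ltW; apply: Nlt; rewrite /= leq_addl.
by rewrite gerBl mulr_ge0// invr_ge0 exprn_ge0.
Qed.

(** * From rigidity to an accumulation point *)

(** Prefixes start at length 1, since elements of the spectrum come from nonempty words; the longer
    of two distinct ones then has length at least 2, as [rigid] demands. *)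
Lemma rigid_injective (K : numFieldType) (A : set K) (beta : K) z :
  beta != 0 -> A 0 -> (forall i, (1 <= i)%N -> A (z i)) -> rigid A beta z ->
  injective (fun n => horner_rec (prefix_word z n.+1) beta).
Proof.
move=> b0 A0 zA zrig.
have neq i j : (i < j)%N ->
    horner_rec (prefix_word z i.+1) beta <> horner_rec (prefix_word z j.+1) beta.
  move=> ij eqij; pose d := (j - i)%N.
  have d0 : (0 < d)%N by rewrite subn_gt0.
  have jE : j.+1 = (i.+1 + d)%N by rewrite addSn subnKC// ltnW.
  (* Since [A 0], padding the prefix of length [i.+1] with leading zeros gives
     a word that contradicts rigidity. *)
  apply: (zrig j.+1 (fun k => if (k <= d)%N then 0 else z (k - d)%N)).
  - by rewrite ltnS (leq_ltn_trans _ ij).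
  - by move=> k _; case: leqP => // dk; apply: zA; rewrite subn_gt0.
  rewrite sum_prefix_word// -eqij.
  rewrite (@big_cat_nat _ _ _ d.+1)//=; last by rewrite jE ltnS leq_addl.
  rewrite big_nat big1 ?add0r => [|k /andP[_]]; last by rewrite ltnS => ->; rewrite mul0r.
  rewrite -[d.+1]add1n big_addn jE -addSn addnK.
  under eq_big_nat => k /andP[k1 _].
    rewrite leqNgt -{1}[d]add0n ltn_add2r k1 /= addnK exprD invfM mulrA.
    over.
  by rewrite -mulr_suml sum_prefix_word// exprD invfM mulrA.
move=> i j /= eqij; case: (ltngtP i j) => // [/neq|/neq]; first by [].
by move/nesym.
Qed.

Lemma bounded_injective_accumulation (R : realType) (u : nat -> R[i]) (C : R[i])
    (X : set R[i]) :
  injective u -> (forall n, `|u n| <= C) -> (forall n, X (u n)) ->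
  exists s, accumulation_point X s.
Proof.
move=> uinj uC uX; pose c := complex.Re C.
have C0 : 0 <= C by apply: le_trans (uC 0%N).
have CE : C = c%:C%C by rewrite RRe_real ?ger0_real.
have normE n : complex.Re (u n) ^+ 2 + complex.Im (u n) ^+ 2 <= c ^+ 2.
  have := uC n; rewrite normc_def CE lecR => uc.
  have c0 : 0 <= c by rewrite -lecR -CE.
  by rewrite -ler_sqrt ?sqr_ge0// sqrtr_sqr (ger0_norm c0).
have c0 : 0 <= c by rewrite -lecR -CE.
have part x y : x ^+ 2 + y ^+ 2 <= c ^+ 2 -> x \in `[- c, c].
  move=> xy; rewrite in_itv /= -ler_norml -[c]ger0_norm// -ler_sqr ?nnegrE//.
  by rewrite !real_normK ?num_real//; apply: le_trans xy; rewrite lerDl sqr_ge0.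
pose v n : R * R := (complex.Re (u n), complex.Im (u n)).
have Kcomp : compact (`[- c, c]%classic `*` `[- c, c]%classic : set (R * R)).
  by apply: compact_setX; exact: segment_compact.
(* Bolzano-Weierstrass: the sequence, read in the plane, stays in a compact square and has a cluster
   point there. *)
have [|[a b] [_ vab]] := Kcomp (v @ \oo) _.
  exists 0%N => // n _; split; first exact: part (normE n).
  by apply: part (complex.Re (u n)) _; rewrite addrC; exact: normE.
exists (a +i* b)%C => U /nbhs_ballP[e /= e0 eU] fin.
have eE : e = (complex.Re e)%:C%C by rewrite RRe_real ?gtr0_real.
have e0' : 0 < complex.Re e / 2 by rewrite divr_gt0// -ltcR -eE.
(* By injectivity, a finite [U] part of [X] is visited at finitely many indices, yet the cluster
   point forces a visit after the last of them. *)
have /finite_seqP[s sE] : finite_set (u @^-1` (U `&` X)).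
  by apply: finite_preimage fin => x y _ _; exact: uinj.
have [] := vab [set v n | n in [set n | (\max_(k <- s) k < n)%N]]
  (ball (a, b) (complex.Re e / 2)).
- by exists (\max_(k <- s) k).+1 => // n /= sn; exists n.
- exact: nbhsx_ballx.
move=> _ [[n /= sn <-] [/= ball1 ball2]].
suff Un : n \in s.
  by move: sn; rewrite ltnNge (@leq_bigmax_seq _ s predT id).
suff : [set` s] n by [].
rewrite -sE; split; last exact: uX.
apply: eU; rewrite -ball_normE /=.
move: ball1 ball2; rewrite -ball_normE /= => ball1 ball2.
have -> : (a +i* b)%C - u n =
    (a - complex.Re (u n))%:C%C + (0 +i* (b - complex.Im (u n)))%C.
  by case: (u n) => x y; apply/eqP; rewrite eq_complex /= addr0 add0r !eqxx.
apply: le_lt_trans (ler_normD _ _) _.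
rewrite !normc_def /= !expr0n addr0 add0r !sqrtr_sqr -rmorphD eE ltcR.
by rewrite [ltRHS](splitr (complex.Re e)) ltrD.
Qed.

Theorem theorem3p5 (R : realType) (beta : R[i]) (A : set R[i]) :
  1 < `|beta| -> finite_set A ->
  ((exists s : R[i], accumulation_point (spectrum A beta) s) ->
   (exists z : nat -> R[i], zero_representation A beta z /\ rigid A beta z))
  /\
  (A 0 ->
   (exists z : nat -> R[i], zero_representation A beta z /\ rigid A beta z) ->
   (exists s : R[i], accumulation_point (spectrum A beta) s)).
Proof.
move=> b1 Afin; have b0 : beta != 0 by rewrite -normr_gt0 (lt_trans _ b1).
split=> [[s sacc]|A0 [z [zrep zrig]]].
  have [z zmin [C zC]] := accumulation_bounded_minimal_word b1 Afin sacc.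
  exists z; split; first split.
  - move=> [//|i] _; apply: (zmin i.+1).1; exact: mem_head.
  - have C0 : 0 <= C by apply: le_trans (zC 0%N).
    apply/cvgr0Pnorm_lt => e e0.
    have := near_complex_geometric b1 C0 e0.
    apply: filterS => n; apply: le_lt_trans; rewrite sum_prefix_word//.
    by rewrite normrM normfV normrX ler_wpM2r ?invr_ge0 ?exprn_ge0.
  (* Shifted down by one index, [z'] is a word of length [j] with the value of the prefix of length
     [j.+1], against the minimality of that prefix. *)
  move=> [//|j] z' j1 z'A; rewrite sum_prefix_word//.
  rewrite big_add1 /=.
  under eq_bigr => i _ do rewrite exprS invfM mulrCA mulrC.
  rewrite -mulr_suml (sum_prefix_word (fun i => z' i.+1))//.
  rewrite -mulrA -invfM -exprSr => /(mulIf (invr_neq0 (expf_neq0 _ b0))) eqz.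
  have := (zmin j.+1).2 (prefix_word (fun i => z' i.+1) j).
  rewrite !size_prefix_word ltnn => short; suff : false by [].
  apply: short (esym eqz).
  by apply: prefix_word_letters => i /andP[i0 ij]; apply: z'A; rewrite !ltnS i0.
have [C zC] := zero_representation_bounded b1 Afin zrep.
apply: (@bounded_injective_accumulation _
  (fun n => horner_rec (prefix_word z n.+1) beta) C).
- exact: rigid_injective zrep.1 zrig.
- by move=> n; exact: zC.
- move=> n; apply/spectrumP; exists (prefix_word z n.+1).
  by split=> //; apply: prefix_word_letters => i /andP[i0 _]; exact: zrep.1.
Qed.
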